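(* Let $t\in(0,1)$ and $p\in(0,1]$, and put $$R_{t,p}=\begin{cases}\dfrac{1-t+tp-2\sqrt{(1-t)(tp+1-t)}}{tp-3+3t}, & t\neq\dfrac{3}{p+3},\\[2mm] \dfrac12, & t=\dfrac{3}{p+3}.\end{cases}$$ Then for every analytic function $f(z)=\sum_{k=0}^\infty a_kz^k$ on $\mathbb{D}$ with $|f(z)|<1$ for all $z\in\mathbb{D}$, $$t|f(z)|^{p}+(1-t)\sum_{k=0}^{\infty}|a_{k}||z|^{k}\leq 1\qquad\text{for all } z\text{ with } |z|=r\le R_{t,p}.$$ Furthermore, the radius $R_{t,p}$ is the best possible.
   Context: $\mathbb{D}=\{z\in\mathbb{C}:|z|<1\}$ is the open unit disk. The radius $R_{t,p}$ being best possible means that, for the given $(t,p)$, it cannot be replaced by any larger number: for every $R'$ with $R_{t,p}<R'<1$ there are an analytic $f(z)=\sum_{k\ge0} a_kz^k$ on $\mathbb{D}$ with $|f|<1$ on $\mathbb{D}$ and a point $z$ with $|z|\le R'$ for which the inequality fails. *)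

(* Defs.v *)
From HB Require Import structures.
From mathcomp Require Import all_boot all_order all_algebra.
From mathcomp Require Import all_classical all_reals all_analysis.
From mathcomp Require Import complex.

Set Implicit Arguments.
Unset Strict Implicit.
Unset Printing Implicit Defensive.

Import Order.TTheory GRing.Theory Num.Theory.
Import numFieldNormedType.Exports.
Import ComplexField.Normc.

Local Open Scope classical_set_scope.
Local Open Scope ring_scope.
Local Open Scope complex_scope.

(* The R-valued modulus normc is used instead of the norm `|z|, which on R[i]
   takes its values in R[i]. *)
Definition unit_disk (R : realType) : set R[i] := [set z | normc z < 1].

(* Complex derivability at every point: the scalar field is R[i], so the
   difference quotient is taken over complex increments. The normed-module
   (hence topological) structure is carried by the alias R[i]^o of R[i]. *)
Definition analytic_on (R : realType) (D : set R[i]) (f : R[i] -> R[i]) : Prop :=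
  forall z, D z -> derivable (f : R[i]^o -> R[i]^o) z 1.

Definition has_power_series_on (R : realType) (D : set R[i])
    (a : nat -> R[i]) (f : R[i] -> R[i]) : Prop :=
  forall z, D z -> series (fun k => a k * z ^+ k : R[i]^o) n @[n --> \oo] --> (f z : R[i]^o).

Definition analytic_self_map (R : realType) (f : R[i] -> R[i])
    (a : nat -> R[i]) : Prop :=
  [/\ analytic_on (@unit_disk R) f,
      has_power_series_on (@unit_disk R) a f
    & forall z, unit_disk z -> normc (f z) < 1].

Definition bohr_radius (R : realType) (t p : R) : R :=
  if t == 3 / (p + 3) then 1 / 2
  else (1 - t + t * p - 2 * Num.sqrt ((1 - t) * (t * p + 1 - t)))
       / (t * p - 3 + 3 * t).

(* The series is summed in \bar R, so the inequality includes its convergence.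
   Note 0 `^ p = 0 for p != 0. *)
Definition bohr_inequality (R : realType) (t p : R) (f : R[i] -> R[i])
    (a : nat -> R[i]) (z : R[i]) : Prop :=
  ((t * normc (f z) `^ p)%:E
   + (1 - t)%:E * \sum_(0 <= k <oo) (normc (a k) * normc z ^+ k)%:E <= 1)%E.

(* Main.v *)
Require Import Defs.
From mathcomp Require Import all_boot all_order all_algebra.
From mathcomp Require Import all_classical all_reals all_analysis.
From mathcomp Require Import complex.
From mathcomp Require Import cyclic separable cyclotomic.
From mathcomp Require Import ring lra zify.

Import Order.TTheory GRing.Theory Num.Theory.
Import numFieldNormedType.Exports.
Import ComplexField.Normc.

Local Open Scope ring_scope.

(** Write x = |a_0| and r = |z|. Two classical estimates for an analytic function
bounded by 1 carry the proof: |a_k| <= 1 - x^2 for k >= 1 ([coef_bound]) and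
|f(z)| <= (x + r) / (1 + x r) ([schwarz_pick]). As p <= 1, the power lies below
its tangent at 1, so that the left-hand side is at most
  1 - (1 - x) (t p (1 - r) / (1 + x r) + (1 - t) (1 - (1 + x) r / (1 - r))).
The last factor decreases in x, and at x = 1 it is nonnegative exactly when
t p (1 - r)^2 >= (1 - t) (3 r - 1) (1 + r), that is, when r is at most the radius:
with u = sqrt (t p + 1 - t) and s = sqrt (1 - t), the radius is u / (u + 2 s)
([bohr_radiusE]) and the condition reads u (1 - r) >= 2 s r ([bohr_radius_cond]).

For r beyond the radius the condition fails strictly. The function
(alpha - z) / (1 - alpha z) at z = - r attains the Schwarz-Pick bound, its
coefficients are explicit, and as alpha tends to 1 the defect divided by
1 - alpha tends to a positive multiple of the (now negative) difference of the
two sides of the condition ([bohr_radius_sharp]).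

Both classical estimates are obtained without integration. For polynomials,
Parseval's identity over roots of unity ([discrete_parseval]) shows that
multiplication by a function bounded by 1 does not increase the sum of the
squared moduli of the coefficients. Hence every finite section of the Toeplitz
matrix of the coefficients of f is a contraction ([toeplitz_contraction]).
Tested on a vector with two nonzero entries, this gives the coefficient bound;
its transpose, tested on geometric sequences, gives the Pick form of f at 0 and z
([pick_form]) and thus the Schwarz-Pick bound. *)

Set Implicit Arguments.
Unset Strict Implicit.

(** * Mean squares over roots of unity *)

Lemma exists_prim_root (C : numClosedFieldType) (n : nat) :
  (0 < n)%N -> exists w : C, n.-primitive_root w.
Proof.
move=> n_gt0; have [r Dr] := closed_field_poly_normal ('X^n - 1 : {poly C}).
have {}Dr : 'X^n - 1 = \prod_(z <- r) ('X - z%:P).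
  by rewrite Dr lead_coefXnsubC // scale1r.
have unity_r : all n.-unity_root r.
  by apply/allP => z; rewrite -root_prod_XsubC -Dr.
have size_r : (n <= size r)%N.
  by rewrite -ltnS -(size_prod_XsubC r id) -Dr size_XnsubC.
have uniq_r : uniq r.
  by rewrite -separable_prod_XsubC -Dr separable_Xn_sub_1 // pnatr_eq0 -lt0n.
by have /hasP[w _] := has_prim_root n_gt0 unity_r uniq_r size_r; exists w.
Qed.

Lemma norm_unity_root (C : numClosedFieldType) (n : nat) (w : C) :
  n.-primitive_root w -> `|w| = 1.
Proof.
move=> w_prim; apply: (@pexpIrn _ n (prim_order_gt0 w_prim)).
- by rewrite nnegrE.
- by rewrite nnegrE.
- by rewrite -normrX (prim_expr_order w_prim) normr1 expr1n.
Qed.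

Lemma prim_root_orthogonality (C : numClosedFieldType) (n : nat) (w : C)
    (k l : 'I_n) : n.-primitive_root w ->
  \sum_(j < n) w ^+ (j * k) * (w ^+ (j * l))^* = n%:R *+ (k == l).
Proof.
move=> w_prim.
have ww1 : w * w^* = 1 by rewrite -normCK (norm_unity_root w_prim) expr1n.
pose u := w ^+ k * w^* ^+ l.
transitivity (\sum_(j < n) u ^+ j).
  apply: eq_bigr => j _.
  by rewrite rmorphXn /= !(mulnC j) !exprM -exprMn.
have [eq_kl|neq_kl] := eqVneq k l.
  under eq_bigr do rewrite /u eq_kl -exprMn ww1 !expr1n.
  by rewrite sumr_const card_ord.
have : (u - 1) * \sum_(j < n) u ^+ j = 0.
  rewrite -subrX1 /u exprMn !(exprAC _ _ n) -rmorphXn /=.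
  by rewrite (prim_expr_order w_prim) rmorph1 !expr1n mulr1 subrr.
move/eqP; rewrite mulf_eq0 => /orP[|/eqP //].
rewrite subr_eq0 => /eqP /(congr1 ( *%R^~ (w ^+ l))).
rewrite /u -mulrA -exprMn (mulrC w^*) ww1 expr1n mulr1 mul1r => /eqP.
rewrite (eq_prim_root_expr w_prim) !modn_small // => /eqP eq_kl.
by rewrite -val_eqE /= eq_kl eqxx in neq_kl.
Qed.

(** Averaging over the n-th roots of unity replaces integration over the circle; it
is exact for polynomials of size at most n. *)
Lemma discrete_parseval (C : numClosedFieldType) (n : nat) (w c : C)
    (p : {poly C}) : n.-primitive_root w -> (size p <= n)%N ->
  \sum_(j < n) `|p.[c * w ^+ j]| ^+ 2 =
  n%:R * \sum_(k < n) `|p`_k * c ^+ k| ^+ 2.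
Proof.
move=> w_prim size_p.
pose q (k : 'I_n) := p`_k * c ^+ k.
transitivity (\sum_(j < n) \sum_(k < n) \sum_(l < n)
    q k * (q l)^* * (w ^+ (j * k) * (w ^+ (j * l))^*)).
  apply: eq_bigr => j _.
  have -> : p.[c * w ^+ j] = \sum_(k < n) q k * w ^+ (j * k).
    rewrite (horner_coef_wide _ size_p); apply: eq_bigr => k _.
    by rewrite exprMn mulrA -exprM.
  rewrite normCK rmorph_sum mulr_suml; apply: eq_bigr => k _.
  rewrite mulr_sumr; apply: eq_bigr => l _.
  by rewrite rmorphM mulrACA.
rewrite exchange_big /= [RHS]mulr_sumr; apply: eq_bigr => k _.
rewrite exchange_big /= (bigD1 k) //= -mulr_sumr prim_root_orthogonality //.
rewrite eqxx -normCK [n%:R * _]mulrC [X in _ + X]big1 ?addr0 // => l neq_lk.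
by rewrite -mulr_sumr prim_root_orthogonality // eq_sym (negPf neq_lk) mulr0.
Qed.

(** Multiplication by F is bounded by its supremum on a circle for the mean square
norm there, and Parseval turns that norm into a weighted sum of squared
coefficients. Dropping the high coefficients of the product leaves an inequality
that depends on F only through K and its first n coefficients. *)
Lemma multiplier_coef_bound (C : numClosedFieldType) (rho K : C)
    (F P : {poly C}) (n : nat) : 0 <= rho ->
  (forall z : C, `|z| = rho -> `|F.[z]| <= K) -> (size P <= n)%N ->
  \sum_(k < n) `|(F * P)`_k * rho ^+ k| ^+ 2 <=
  K ^+ 2 * \sum_(k < n) `|P`_k * rho ^+ k| ^+ 2.
Proof.
move=> rho_ge0 F_le size_P.
(* N exceeds the degree of F * P, so that the N-th roots of unity see each of
   its coefficients separately. *)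
pose N := (size F + n).+1.
have [w w_prim] := @exists_prim_root C N isT.
have N_gt0 : 0 < N%:R :> C by rewrite ltr0n.
have on_circle j : `|rho * w ^+ j| = rho.
  by rewrite normrM normrX (norm_unity_root w_prim) expr1n mulr1 ger0_norm.
have size_FP : (size (F * P)%R <= N)%N.
  apply: leq_trans (size_polyMleq F P) _.
  by rewrite (leq_trans (leq_pred _)) // ltnW // ltnS leq_add2l.
have n_le_N : (n <= N)%N by rewrite ltnW // ltnS leq_addl.
have size_PN : (size P <= N)%N by exact: leq_trans n_le_N.
rewrite -(ler_pM2l N_gt0) mulrCA.
rewrite (big_ord_widen N (fun k => `|P`_k * rho ^+ k| ^+ 2)) //.
have -> : \sum_(k < N | (k < n)%N) `|P`_k * rho ^+ k| ^+ 2 =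
          \sum_(k < N) `|P`_k * rho ^+ k| ^+ 2.
  rewrite big_mkcond; apply: eq_bigr => k _; case: ltnP => // le_nk.
  by rewrite nth_default ?mul0r ?normr0 ?expr0n // (leq_trans size_P).
apply: (@le_trans _ _ (\sum_(j < N) `|(F * P).[rho * w ^+ j]| ^+ 2)).
  rewrite (discrete_parseval _ w_prim) // ler_pM2l //.
  rewrite (big_ord_widen N (fun k => `|(F * P)`_k * rho ^+ k| ^+ 2)) //.
  rewrite big_mkcond; apply: ler_sum => k _.
  by case: ifP => // _; exact: exprn_ge0.
rewrite -(discrete_parseval _ w_prim) // mulr_sumr; apply: ler_sum => j _.
have F_le_j := F_le _ (on_circle j).
by rewrite hornerM normrM exprMn ler_wpM2r ?exprn_ge0 // lerXn2r ?nnegrE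
  ?(le_trans _ F_le_j).
Qed.

(** * Complex moduli, limits and geometric sums *)

Local Open Scope complex_scope.
Local Open Scope classical_set_scope.

Lemma normcC (R : realType) (z : R[i]) : `|z| = (normc z)%:C.
Proof. by []. Qed.

Lemma normc_ge0 (R : realType) (z : R[i]) : 0 <= normc z.
Proof. by rewrite -ler0c -normcC. Qed.

Lemma normcX (R : realType) (z : R[i]) n : normc (z ^+ n) = normc z ^+ n.
Proof. by apply: complexI; rewrite rmorphXn /= -!normcC normrX. Qed.

Lemma normc_real (R : realType) (x : R) : normc x%:C = `|x|.
Proof. by rewrite /= expr0n /= addr0 sqrtr_sqr. Qed.

Lemma normc_conjc (R : realType) (z : R[i]) : normc (conjc z) = normc z.
Proof. by apply: complexI; rewrite -!normcC normcJ. Qed.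

Lemma normc_sum_le (R : realType) (u : nat -> R[i]) m n :
  normc (\sum_(m <= k < n) u k) <= \sum_(m <= k < n) normc (u k).
Proof.
rewrite -lecR -normcC rmorph_sum /=.
apply: le_trans (ler_norm_sum _ _ _) _; rewrite le_eqVlt; apply/orP; left.
by apply/eqP/eq_bigr => k _; rewrite normcC.
Qed.

Lemma cvg_normc (R : realType) (u : nat -> R[i]) (l : R[i]) :
  (u n : R[i]^o) @[n --> \oo] --> (l : R[i]^o) ->
  normc (u n) @[n --> \oo] --> normc l.
Proof.
move=> u_l; apply/cvgrPdist_lt => e e_gt0.
have e_gt0' : 0 < e%:C by rewrite ltcR.
near=> n.
have : `|l - u n| < e%:C.
  by near: n; move/cvgrPdist_lt : u_l; apply.
rewrite normcC ltcR; apply: le_lt_trans.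
rewrite ler_norml lerBlDr; apply/andP; split; last first.
  by apply: le_trans (le_normcD _ _); rewrite subrK.
rewrite lerBrDr addrC lerBlDr -[normc (l - u n)]normcN opprB addrC.
by apply: le_trans (le_normcD _ _); rewrite subrK.
Unshelve. all: by end_near. Qed.

Lemma cvg_sqr_normc (R : realType) (u : nat -> R[i]) (l : R[i]) :
  (u n : R[i]^o) @[n --> \oo] --> (l : R[i]^o) ->
  normc (u n) ^+ 2 @[n --> \oo] --> normc l ^+ 2.
Proof.
move=> u_l; apply: (@cvg_comp _ _ _ _ (fun x : R => x ^+ 2) _ _ _ (cvg_normc u_l)).
exact: exprn_continuous.
Qed.

Lemma cvg_of_normc (R : realType) (u : nat -> R[i]) (l : R[i]) :
  normc (l - u n) @[n --> \oo] --> (0 : R) ->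
  (u n : R[i]^o) @[n --> \oo] --> (l : R[i]^o).
Proof.
move=> u_l; apply/cvgrPdist_lt => e e_gt0.
have eE : e = (complex.Re e)%:C by rewrite RRe_real // gtr0_real.
rewrite eE ltcR in e_gt0; near=> n.
rewrite eE normcC ltcR.
near: n; exact: (cvgr_lt 0).
Unshelve. all: by end_near. Qed.

Lemma le_of_lt_scale (R : realType) (x y : R) (m : nat) :
  (forall s, 0 < s -> s < 1 -> s ^+ m * x <= y) -> x <= y.
Proof.
move=> sxy.
have lim_x : (fun s : R => s ^+ m * x) @ (1 : R)^'- --> x.
  apply: cvg_at_left_filter.
  suff: (fun s : R => s ^+ m * x) @ (1 : R) --> (1 ^+ m * x : R).
    by rewrite expr1n mul1r.
  by apply: cvgM; [exact: exprn_continuous | exact: cvg_cst].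
apply: (cvgr_to_le lim_x); near=> s; apply: sxy; near: s.
  exact: nbhs_left_gt.
exact: nbhs_left_lt.
Unshelve. all: by end_near. Qed.

Lemma geometric_sum_cvg (R : realType) (q : R) : 0 <= q -> q < 1 ->
  \sum_(i < m) q ^+ i.+1 @[m --> \oo] --> q / (1 - q).
Proof.
move=> q_ge0 q_lt1.
have geoE m : \sum_(i < m) q ^+ i.+1 = series (geometric q q) m.
  by rewrite /series /= big_mkord; apply: eq_bigr => i _; rewrite exprS.
by rewrite (eq_cvg _ _ geoE); apply: cvg_geometric_series; rewrite ger0_norm.
Qed.

Lemma geometric_sum_le (R : realType) (q : R) m : 0 <= q -> q < 1 ->
  \sum_(i < m) q ^+ i.+1 <= q / (1 - q).
Proof.
move=> q_ge0 q_lt1.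
apply: (cvgr_to_ge (geometric_sum_cvg q_ge0 q_lt1)); near=> M.
have mM : (m <= M)%N by near: M; exact: nbhs_infty_ge.
rewrite -!(big_mkord xpredT (fun i => q ^+ i.+1)).
rewrite (big_cat_nat (leq0n m) mM) //= lerDl sumr_ge0 // => k _.
exact: exprn_ge0.
Unshelve. all: by end_near. Qed.

(** * Power series bounded by 1 on the disk *)

Section power_series.
Context (R : realType).
Implicit Types (a b : nat -> R[i]) (f : R[i] -> R[i]).

Lemma power_series_at0 a f :
  has_power_series_on (@unit_disk R) a f -> f 0 = a 0%N.
Proof.
move=> fa; have disk0 : @unit_disk R 0.
  by rewrite /unit_disk /mkset normc0 ltr01.
have : series (fun k => a k * 0 ^+ k : R[i]^o) n @[n --> \oo] --> (a 0%N : R[i]^o).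
  rewrite -cvg_shiftS /=; apply: cvg_near_cst; near=> n.
  rewrite /series /= big_nat_recl // expr0 mulr1 big1 ?addr0 // => i _.
  by rewrite expr0n mulr0.
by move: (fa 0 disk0); exact: cvg_unique.
Unshelve. all: by end_near. Qed.

Lemma coef0_lt1 a f :
  has_power_series_on (@unit_disk R) a f ->
  (forall z, unit_disk z -> normc (f z) < 1) -> normc (a 0%N) < 1.
Proof.
move=> fa f_lt1; rewrite -(power_series_at0 fa); apply: f_lt1.
by rewrite /unit_disk /mkset normc0 ltr01.
Qed.

Lemma power_series_summable a f (rho : R) :
  has_power_series_on (@unit_disk R) a f -> 0 <= rho -> rho < 1 ->
  cvgn (series (fun k => normc (a k) * rho ^+ k)).
Proof.
move=> fa rho_ge0 rho_lt1.
(* The terms are bounded at a radius strictly between rho and 1; the ratio of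
   the two radii then gives geometric decay. *)
pose sigma := (1 + rho) / 2.
have sigma_gt0 : 0 < sigma by rewrite /sigma; lra.
have := fa sigma%:C.
rewrite /unit_disk /mkset normc_real gtr0_norm //.
have sigma_lt1 : sigma < 1 by rewrite /sigma; lra.
move=> /(_ sigma_lt1) /cvgP /cvg_series_cvg_0 /cvg_normc.
rewrite normc0 => /cvgP/cvg_seq_bounded [B [_ Bterm]].
have {}Bterm n : normc (a n) * sigma ^+ n <= B + 1.
  have := Bterm (B + 1) _ n I; rewrite ltrDl ltr01 => /(_ isT); rewrite /mkset.
  rewrite ger0_norm ?normc_ge0 // normcM normcX normc_real gtr0_norm //.
have theta_ge0 : 0 <= rho / sigma by rewrite divr_ge0 // ltW.
have theta_lt1 : `|rho / sigma| < 1.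
  rewrite ger0_norm // ltr_pdivrMr // mul1r /sigma; lra.
apply: series_le_cvg (is_cvg_geometric_series (a := B + 1) theta_lt1) => n.
- by rewrite mulr_ge0 ?normc_ge0 ?exprn_ge0.
- rewrite /geometric /= mulr_ge0 ?exprn_ge0 //.
  by apply: le_trans (Bterm 0%N); rewrite expr0 mulr1 normc_ge0.
rewrite /geometric /= expr_div_n mulrCA mulrC; apply: ler_wpM2l.
  by rewrite exprn_ge0.
by rewrite ler_pdivlMr ?exprn_gt0.
Qed.

(** A partial sum differs from the sum f(z), of modulus below 1, by a tail that is
controlled on the whole circle at once by absolute convergence. *)
Lemma partial_sums_bounded a f (rho delta : R) :
  has_power_series_on (@unit_disk R) a f ->
  (forall z, unit_disk z -> normc (f z) < 1) ->
  0 <= rho -> rho < 1 -> 0 < delta ->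
  \forall M \near \oo, forall z, normc z = rho ->
    normc (\sum_(k < M) a k * z ^+ k) <= 1 + delta.
Proof.
move=> fa f_lt1 rho_ge0 rho_lt1 delta_gt0.
have /cvg_cauchy/cauchy_seriesP/(_ _ delta_gt0) :=
  power_series_summable fa rho_ge0 rho_lt1.
move=> [[A B] /= [[N _ AN] [N' _ BN']] tail].
exists (maxn N N') => // M /=; rewrite geq_max => /andP[NM N'M] z z_rho.
have z_disk : unit_disk z by rewrite /unit_disk /mkset z_rho.
have /cvg_normc fz := fa z z_disk.
rewrite -lerBlDr.
apply: (@le_trans _ _ (normc (f z))); last exact/ltW/f_lt1.
apply: (@cvgr_to_ge _ _ _ _ _ _ _ fz).
near=> M'.
have MM' : (M <= M')%N by near: M'; exact: nbhs_infty_ge.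
rewrite lerBlDr /series /= -(big_mkord xpredT (fun k => a k * z ^+ k)).
have -> : \sum_(0 <= k < M) a k * z ^+ k =
    \sum_(0 <= k < M') a k * z ^+ k - \sum_(M <= k < M') a k * z ^+ k.
  by rewrite [X in _ = X - _](big_cat_nat _ MM') //= addrK.
apply: le_trans (le_normcD _ _) _; rewrite lerD2l normcN.
apply: le_trans (normc_sum_le _ _ _) _.
have := tail (M, M') (conj (AN M NM) (BN' M' (leq_trans N'M MM'))).
rewrite /=; move/ltW; apply: le_trans; apply: le_trans (ler_norm _).
by apply: ler_sum => k _; rewrite normcM normcX z_rho.
Unshelve. all: by end_near. Qed.

(** The lower triangular Toeplitz matrix of the coefficients of a function bounded
by 1 is a contraction. Everything needed about such functions is read off from
this: its 2 by 2 compressions give the coefficient estimate, its action on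
geometric sequences the Schwarz-Pick estimate. *)
Lemma toeplitz_contraction a f (b : nat -> R[i]) n :
  has_power_series_on (@unit_disk R) a f ->
  (forall z, unit_disk z -> normc (f z) < 1) ->
  \sum_(k < n) normc (\sum_(j < k.+1) a (k - j)%N * b j) ^+ 2 <=
  \sum_(k < n) normc (b k) ^+ 2.
Proof.
move=> fa f_lt1.
(* On the circle of radius s the long truncations of f are at most 1/s. Comparing the
   weights s^2k with s^2n and 1 costs s^2n, the square of 1/s another s^2. *)
apply: (@le_of_lt_scale _ _ _ (n * 2 + 2)) => s s_gt0 s_lt1.
have delta_gt0 : 0 < s^-1 - 1 by rewrite subr_gt0 invf_gt1.
have near_n : \forall M \near \oo, (n <= M)%N by exact: nbhs_infty_ge.
have [M [sum_le nM]] : exists M, (forall z, normc z = s ->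
    normc (\sum_(k < M) a k * z ^+ k) <= s^-1) /\ (n <= M)%N.
  have [M [/= Mle nM]] := filter_ex (filterI
    (partial_sums_bounded fa f_lt1 (ltW s_gt0) s_lt1 delta_gt0) near_n).
  exists M; split=> // z /Mle.
  by rewrite addrC subrK.
pose F := \poly_(i < M) a i; pose P := \poly_(i < n) b i.
have F_le (z : R[i]) : `|z| = s%:C -> `|F.[z]| <= (s^-1)%:C.
  move=> /complexI z_s; rewrite normcC lecR horner_poly; exact: sum_le.
have s_ge0 : 0 <= s%:C by rewrite ler0c ltW.
have := multiplier_coef_bound s_ge0 F_le (size_poly n b).
have tr (q : nat -> R[i]) : \sum_(k < n) `|q k * s%:C ^+ k| ^+ 2 =
    (\sum_(k < n) normc (q k) ^+ 2 * s ^+ (2 * k))%:C.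
  rewrite rmorph_sum; apply: eq_bigr => k _.
  rewrite normcC -rmorphXn /= normcM normcX normc_real gtr0_norm //.
  by rewrite exprMn -exprM mulnC.
rewrite (tr (fun k => (F * P)`_k)) (tr (fun k => P`_k)).
rewrite -rmorphXn -rmorphM lecR => main.
have s_pow_le1 k : s ^+ k <= 1 by rewrite exprn_ile1 // ltW.
rewrite exprD -mulrA mulrCA -ler_pdivlMl ?exprn_gt0 // -exprVn.
apply: (@le_trans _ _ (\sum_(k < n) normc (F * P)`_k ^+ 2 * s ^+ (2 * k))).
  rewrite mulr_sumr; apply: ler_sum => k _; rewrite mulrC.
  have -> : (F * P)`_k = \sum_(j < k.+1) a (k - j)%N * b j.
    rewrite coefMr; apply: eq_bigr => j _; rewrite !coef_poly.
    have jn : (j < n)%N by apply: leq_trans (ltn_ord j) (ltn_ord k).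
    by rewrite jn (leq_ltn_trans (leq_subr _ _)) // (leq_trans (ltn_ord k)).
  rewrite ler_wpM2l ?exprn_ge0 ?normc_ge0 //.
  by rewrite mulnC ler_wiXn2l ?(ltW s_gt0) ?(ltW s_lt1) // leq_mul2l ltnW.
apply: le_trans main _; rewrite ler_wpM2l ?exprn_ge0 ?invr_ge0 ?(ltW s_gt0) //.
apply: ler_sum => k _; rewrite coef_poly ltn_ord.
by rewrite ler_piMr // exprn_ge0 ?normc_ge0.
Qed.

(** Testing the contraction on a vector supported on the indices 0 and k + 1, chosen
to make the inequality tight, replaces the averaging argument of Wiener. *)
Lemma coef_bound a f k :
  has_power_series_on (@unit_disk R) a f ->
  (forall z, unit_disk z -> normc (f z) < 1) ->
  normc (a k.+1) <= 1 - normc (a 0%N) ^+ 2.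
Proof.
move=> fa f_lt1; have a0_lt1 := coef0_lt1 fa f_lt1.
set x := normc (a 0%N) in a0_lt1 *; set y := normc (a k.+1).
have x_ge0 : 0 <= x := normc_ge0 _; have y_ge0 : 0 <= y := normc_ge0 _.
have a0a0 : a 0%N * conjc (a 0%N) = (x ^+ 2)%:C.
  by rewrite -sqr_normc normcC rmorphXn.
have x2_lt1 : x ^+ 2 < 1 by rewrite expr_lt1.
(* With this c and the entry at k.+1 below, the output entry at k.+1 is
   a_k+1 * (1 - |a_0|^2) + a_0 * conj(a_0) * a_k+1 = a_k+1.
   The existential keeps c opaque to simplification. *)
have [c cE] : exists c : R[i], c = (1 - x ^+ 2)%:C by exists (1 - x ^+ 2)%:C.
have norm_c : normc c = 1 - x ^+ 2 by rewrite cE normc_real gtr0_norm // subr_gt0.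
have nc0 : normc (0 : R[i]) ^+ 2 = 0 by rewrite normc0 expr0n.
pose b j : R[i] := if j is j'.+1 then
  (if j' == k then conjc (a 0%N) * a k.+1 else 0) else c.
have := toeplitz_contraction b k.+2 fa f_lt1.
have -> : \sum_(j < k.+2) normc (b j) ^+ 2 = (1 - x ^+ 2) ^+ 2 + (x * y) ^+ 2.
  rewrite big_ord_recl big_ord_recr /= eqxx normcM normc_conjc big1 ?add0r => [|j _].
    by rewrite norm_c.
  by rewrite ltn_eqF; [exact: nc0 | exact: (ltn_ord j)].
have two_terms (e : nat -> R) : (forall i, 0 <= e i) ->
    e 0%N + e k.+1 <= \sum_(i < k.+2) e i.
  move=> e_ge0; rewrite big_ord_recl big_ord_recr /= lerD2l lerDr.
  by apply: sumr_ge0 => i _; exact: e_ge0.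
pose e i := normc (\sum_(j < i.+1) a (i - j)%N * b j) ^+ 2.
move=> /(le_trans (two_terms e (fun i => sqr_ge0 _))); rewrite /e.
have -> : \sum_(j < 1) a (0 - j)%N * b j = a 0%N * c.
  by rewrite big_ord1.
have -> : \sum_(j < k.+2) a (k.+1 - j)%N * b j = a k.+1.
  rewrite big_ord_recl big_ord_recr /= eqxx subnn mulrA a0a0 big1 => [|j _].
    by rewrite add0r subn0 cE rmorphB rmorph1; ring.
  by rewrite ltn_eqF ?mulr0 //; exact: (ltn_ord j).
rewrite normcM norm_c -/x -/y => main.
rewrite -(@ler_pXn2r _ 2) ?nnegrE //; last by rewrite subr_ge0 ltW.
rewrite -(@ler_pM2r _ (1 - x ^+ 2)) ?subr_gt0 //.
rewrite -subr_ge0 in main *; nra.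
Qed.

Lemma abs_series_le a f (r : R) :
  has_power_series_on (@unit_disk R) a f ->
  (forall z, unit_disk z -> normc (f z) < 1) ->
  0 <= r -> r < 1 ->
  (\sum_(0 <= k <oo) (normc (a k) * r ^+ k)%:E <=
   (normc (a 0%N) + (1 - normc (a 0%N) ^+ 2) * (r / (1 - r)))%:E)%E.
Proof.
move=> fa f_lt1 r_ge0 r_lt1.
have x_lt1 := coef0_lt1 fa f_lt1.
have X_ge0 : 0 <= 1 - normc (a 0%N) ^+ 2.
  by rewrite subr_ge0 ltW // expr_lt1 ?normc_ge0.
apply: lime_le.
  apply: is_cvg_nneseries => k _ _.
  by rewrite lee_fin mulr_ge0 ?normc_ge0 ?exprn_ge0.
near=> n; rewrite sumEFin lee_fin.
have n_gt0 : (0 < n)%N by near: n; exact: nbhs_infty_gt.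
rewrite -(prednK n_gt0) big_nat_recl // expr0 mulr1 lerD2l big_mkord.
apply: (@le_trans _ _ ((1 - normc (a 0%N) ^+ 2) * \sum_(i < n.-1) r ^+ i.+1)).
  rewrite mulr_sumr; apply: ler_sum => i _; rewrite ler_wpM2r ?exprn_ge0 //.
  exact: coef_bound fa f_lt1.
by rewrite ler_wpM2l // geometric_sum_le.
Unshelve. all: by end_near. Qed.

(** The transpose of a Toeplitz matrix is the matrix conjugated by the reversal of
indices, so the transpose is a contraction as well. It maps the geometric
sequence of ratio z to its multiples by partial sums of f at z: these sequences
play the role of the reproducing kernels of the Hardy space. *)
Lemma reversed_contraction a f (c d z : R[i]) N :
  has_power_series_on (@unit_disk R) a f ->
  (forall z, unit_disk z -> normc (f z) < 1) ->
  \sum_(i < N.+1) normc (c * z ^+ i * (\sum_(k < (N.+1 - i)%N) a k * z ^+ k)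
                           + a 0%N * d *+ (i == 0%N :> nat)) ^+ 2 <=
  \sum_(i < N.+1) normc (c * z ^+ i + d *+ (i == 0%N :> nat)) ^+ 2.
Proof.
move=> fa f_lt1.
(* Listed backwards, so that entry N - i of the product collects the first
   N + 1 - i terms of f at z. *)
pose b j := c * z ^+ (N - j)%N + d *+ (j == N).
have := toeplitz_contraction b N.+1 fa f_lt1.
rewrite (reindex_inj rev_ord_inj) [X in _ <= X](reindex_inj rev_ord_inj) /=.
have index0 (i : 'I_N.+1) : ((N.+1 - i.+1)%N == N) = (i == 0%N :> nat).
  by have := ltn_ord i; lia.
have rhsE (i : 'I_N.+1) : b (N.+1 - i.+1)%N = c * z ^+ i + d *+ (i == 0%N :> nat).
  by rewrite /b index0 subSS subKn // -ltnS.
under [X in _ <= X -> _]eq_bigr do rewrite rhsE.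
have lhsE (i : 'I_N.+1) :
    \sum_(j < (N.+1 - i.+1).+1) a (N.+1 - i.+1 - j)%N * b j =
    c * z ^+ i * (\sum_(k < (N.+1 - i)%N) a k * z ^+ k)
      + a 0%N * d *+ (i == 0%N :> nat).
  have iN : (i <= N)%N by rewrite -ltnS.
  rewrite subSS subSn // (reindex_inj rev_ord_inj) /= mulr_sumr.
  transitivity (\sum_(k < (N - i).+1) (c * z ^+ i * (a k * z ^+ k)
      + a k * d *+ ((i == 0%N :> nat) && (k == 0%N :> nat)))).
    apply: eq_bigr => k _; have kNi : (k <= N - i)%N by rewrite -ltnS.
    rewrite subSS subKn // /b.
    have -> : (N - (N - i - k))%N = (i + k)%N by lia.
    have -> : (N - i - k == N)%N = (i == 0%N :> nat) && (k == 0%N :> nat) by lia.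
    by rewrite exprD mulrDr mulrnAr; congr (_ + _); ring.
  rewrite big_split /=; congr (_ + _).
  rewrite big_ord_recl /= andbT big1 ?addr0 // => k _.
  by rewrite andbF mulr0n.
by under eq_bigr do rewrite lhsE.
Qed.

(** Positivity of the Pick matrix of f at the points 0 and z, as a quadratic form
in c and d; it is the limit of the previous inequality for infinite sequences. *)
Lemma pick_form a f (c d z : R[i]) :
  has_power_series_on (@unit_disk R) a f ->
  (forall z, unit_disk z -> normc (f z) < 1) -> normc z < 1 ->
  normc (c * f z + a 0%N * d) ^+ 2 +
    normc c ^+ 2 * normc (f z) ^+ 2 * (normc z ^+ 2 / (1 - normc z ^+ 2)) <=
  normc (c + d) ^+ 2 + normc c ^+ 2 * (normc z ^+ 2 / (1 - normc z ^+ 2)).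
Proof.
move=> fa f_lt1 z_lt1; set q := normc z ^+ 2; set E := q / (1 - q).
have q_ge0 : 0 <= q by exact: sqr_ge0.
have q_lt1 : q < 1 by rewrite expr_lt1 ?normc_ge0.
pose geo m := \sum_(i < m) q ^+ i.+1.
have geo_cvg : geo m @[m --> \oo] --> E by exact: geometric_sum_cvg.
have geo_le m : geo m <= E by exact: geometric_sum_le.
pose S N := \sum_(k < N) a k * z ^+ k.
have S_cvg : (S N : R[i]^o) @[N --> \oo] --> (f z : R[i]^o).
  have := fa z z_lt1; rewrite (_ : series _ = S) //.
  by apply/funext => N; rewrite /series /= big_mkord.
(* Only the first m.+1 terms on the left are kept while N goes to infinity;
   m follows afterwards. *)
have finite m :
    normc (c * f z + a 0%N * d) ^+ 2 + normc c ^+ 2 * normc (f z) ^+ 2 * geo m <=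
    normc (c + d) ^+ 2 + normc c ^+ 2 * E.
  pose T N i := normc (c * z ^+ i * S (N.+1 - i)%N
                       + a 0%N * d *+ (i == 0%N :> nat)) ^+ 2.
  have T_cvg (i : nat) : T N i @[N --> \oo] -->
      normc (c * z ^+ i * f z + a 0%N * d *+ (i == 0%N :> nat)) ^+ 2.
    apply: cvg_sqr_normc; apply: cvgD; last exact: cvg_cst.
    apply: cvgM; first exact: cvg_cst.
    move=> A /S_cvg [n0 _ n0A]; exists (n0 + i)%N => // N /= le_N.
    by apply: n0A => /=; lia.
  have -> : normc (c * f z + a 0%N * d) ^+ 2 + normc c ^+ 2 * normc (f z) ^+ 2 * geo m
     = \sum_(i < m.+1) normc (c * z ^+ i * f z + a 0%N * d *+ (i == 0%N :> nat)) ^+ 2.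
    rewrite big_ord_recl /= expr0 mulr1 mulr1n; congr (_ + _).
    rewrite mulr_sumr; apply: eq_bigr => i _.
    rewrite mulr0n addr0 !normcM normcX !exprMn /q -!exprM [RHS]mulrAC.
    by rewrite -exprD addnn -muln2.
  have sum_cvg : \sum_(i < m.+1) T N i @[N --> \oo] -->
      \sum_(i < m.+1) normc (c * z ^+ i * f z + a 0%N * d *+ (i == 0%N :> nat)) ^+ 2.
    by apply: cvg_big => [|i _]; [exact: add_continuous | exact: T_cvg].
  apply: (cvgr_to_le sum_cvg); near=> N.
  have mN : (m.+1 <= N.+1)%N by near: N; exact: nbhs_infty_ge.
  apply: (@le_trans _ _ (\sum_(i < N.+1) T N i)).
    rewrite (big_ord_widen N.+1 (T N)) // big_mkcond; apply: ler_sum => i _.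
    by case: ifP => // _; exact: sqr_ge0.
  apply: le_trans (reversed_contraction c d z N fa f_lt1) _.
  rewrite big_ord_recl /= expr0 mulr1 mulr1n lerD2l.
  apply: (@le_trans _ _ (normc c ^+ 2 * geo N)); last first.
    by rewrite ler_wpM2l ?sqr_ge0.
  rewrite mulr_sumr; apply: ler_sum => i _.
  by rewrite mulr0n addr0 normcM normcX exprMn /q -!exprM mulnC.
have lhs_cvg : normc (c * f z + a 0%N * d) ^+ 2
    + normc c ^+ 2 * normc (f z) ^+ 2 * geo m @[m --> \oo] -->
    normc (c * f z + a 0%N * d) ^+ 2 + normc c ^+ 2 * normc (f z) ^+ 2 * E.
  by apply: cvgD; [exact: cvg_cst | apply: cvgM; [exact: cvg_cst|]].
by apply: (cvgr_to_le lhs_cvg); near=> m; exact: finite.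
Unshelve. all: by end_near. Qed.

Lemma schwarz_pick a f (z : R[i]) :
  has_power_series_on (@unit_disk R) a f ->
  (forall z, unit_disk z -> normc (f z) < 1) ->
  normc z < 1 ->
  normc (f z) <= (normc (a 0%N) + normc z) / (1 + normc (a 0%N) * normc z).
Proof.
move=> fa f_lt1 r_lt1; have x_lt1 := coef0_lt1 fa f_lt1.
(* c = 1 - |a_0|^2 and d = - (1 - f(z) conj(a_0)) turn both squares of the
   form into multiples of |f(z) - a_0|^2. *)
pose abar := conjc (a 0%N).
have := pick_form (1 - a 0%N * abar) (- (1 - f z * abar)) fa f_lt1 r_lt1.
have y_lt1 := f_lt1 z r_lt1.
have -> : (1 - a 0%N * abar) * f z + a 0%N * - (1 - f z * abar) = f z - a 0%N by ring.
have -> : (1 - a 0%N * abar) + - (1 - f z * abar) = abar * (f z - a 0%N) by ring.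
have x2_le1 : 0 < 1 - normc (a 0%N) ^+ 2 by rewrite subr_gt0 expr_lt1 ?normc_ge0.
have -> : 1 - a 0%N * abar = (1 - normc (a 0%N) ^+ 2)%:C.
  by rewrite rmorphB rmorph1 rmorphXn /= -normcC sqr_normc.
rewrite normc_real gtr0_norm // normcM normc_conjc.
have : normc (f z) - normc (a 0%N) <= normc (f z - a 0%N).
  by rewrite lerBlDr; apply: le_trans (le_normcD _ _); rewrite subrK.
move: x2_le1 x_lt1 y_lt1 r_lt1.
have := normc_ge0 (a 0%N); have := normc_ge0 (f z); have := normc_ge0 z.
have := normc_ge0 (f z - a 0%N).
set x := normc (a 0%N); set y := normc (f z); set r := normc z.
set D := normc (f z - a 0%N).
move=> D_ge0 r_ge0 y_ge0 x_ge0 X_gt0 x_lt1 y_lt1 r_lt1 yxD main.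
have r2_gt0 : 0 < 1 - r ^+ 2 by rewrite subr_gt0 expr_lt1.
rewrite ler_pdivlMr; last by rewrite ltr_wpDr ?mulr_ge0.
have xy_le1 : x * y <= 1 by rewrite mulr_ile1 // ltW.
have [yx|xy] := leP y x.
  have : 0 <= r * (1 - x * y) by rewrite mulr_ge0 // subr_ge0.
  by lra.
have D2_le : D ^+ 2 * (1 - r ^+ 2) <= (1 - x ^+ 2) * (1 - y ^+ 2) * r ^+ 2.
  rewrite -ler_pdivlMr // -(@ler_pM2l _ (1 - x ^+ 2)) //.
  move: main; rewrite exprMn; set v := (1 - r ^+ 2)^-1 => main.
  rewrite -subr_ge0 in main *; lra.
have : (y - x) ^+ 2 <= (r * (1 - x * y)) ^+ 2.
  have : (y - x) ^+ 2 <= D ^+ 2 by rewrite ler_pXn2r ?nnegrE // ltW // subr_gt0.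
  nra.
rewrite (ler_pXn2r (ltn0Sn 1)) ?nnegrE; last 2 first.
- by rewrite subr_ge0 ltW.
- by rewrite mulr_ge0 // subr_ge0.
lra.
Qed.

End power_series.

(** * The power function near 1 *)

(** Concavity of the power function: its graph lies below the tangent at 1. *)
Lemma powR_le_tangent (R : realType) (x p : R) :
  0 <= x -> 0 < p -> p <= 1 -> x `^ p <= 1 + p * (x - 1).
Proof.
move=> x_ge0 p_gt0 p_le1.
have [->|x_neq0] := eqVneq x 0; first by rewrite powR0 ?gt_eqF //; lra.
have x_gt0 : 0 < x by rewrite lt_def x_neq0.
rewrite /powR (negPf x_neq0); set v := ln x.
have -> : x = expR v by rewrite lnK.
set E := expR (p * v).
have E_gt0 : 0 < E by exact: expR_gt0.
(* Both terms of the convex combination p * e^v + (1 - p) * 1 are bounded below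
   by the tangent at p * v. *)
have h1 : E * (1 + (1 - p) * v) <= expR v.
  have -> : expR v = E * expR ((1 - p) * v) by rewrite -expRD; congr expR; ring.
  exact: (ler_wpM2l (ltW E_gt0) (expR_ge1Dx _)).
have h2 : E * (1 - p * v) <= 1.
  apply: (@le_trans _ _ (E * expR (- (p * v)))).
    exact: (ler_wpM2l (ltW E_gt0) (expR_ge1Dx _)).
  by rewrite -expRD subrr expR0.
have h3 : p * (E * (1 + (1 - p) * v)) <= p * expR v by rewrite ler_wpM2l // ltW.
have h4 : (1 - p) * (E * (1 - p * v)) <= 1 - p by rewrite ler_piMr // subr_ge0.
lra.
Qed.

(** Up to terms of second order at 1 this is the reverse of the previous bound, and
it follows from that bound at the inverse of x. *)
Lemma powR_ge_tangent_inv (R : realType) (x p : R) :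
  0 < x -> 0 < p -> p <= 1 -> 1 - x `^ p <= p * (x^-1 - 1).
Proof.
move=> x_gt0 p_gt0 p_le1.
have xp_gt0 : 0 < x `^ p by exact: powR_gt0.
have xV_ge0 : 0 <= x^-1 by rewrite invr_ge0 ltW.
have := powR_le_tangent xV_ge0 p_gt0 p_le1.
have vw1 : x `^ p * x^-1 `^ p = 1.
  by rewrite -powRM ?(ltW x_gt0) // divff ?powR1 // gt_eqF.
have : 0 <= x^-1 `^ p * (x `^ p - 1) ^+ 2 by rewrite mulr_ge0 ?powR_ge0 ?sqr_ge0.
have -> : x^-1 `^ p * (x `^ p - 1) ^+ 2 =
    (x `^ p * x^-1 `^ p) * x `^ p - 2 * (x `^ p * x^-1 `^ p) + x^-1 `^ p by ring.
rewrite vw1; lra.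
Qed.

(** * The radius *)

(** With u and s the two square roots, the numerator is u (u - 2 s) and the
denominator (u - 2 s) (u + 2 s). The common factor vanishes exactly when
t = 3 / (p + 3), where the quotient left after cancellation is 1 / 2; hence one
formula covers both cases. *)
Lemma bohr_radiusE (R : realType) (t p : R) : 0 < t -> t < 1 -> 0 < p ->
  bohr_radius t p = Num.sqrt (t * p + 1 - t) /
    (Num.sqrt (t * p + 1 - t) + 2 * Num.sqrt (1 - t)).
Proof.
move=> t_gt0 t_lt1 p_gt0; rewrite /bohr_radius.
have B_gt0 : 0 < 1 - t by rewrite subr_gt0.
have A_gt0 : 0 < t * p by rewrite mulr_gt0.
have U_gt0 : 0 < t * p + 1 - t by lra.
rewrite (sqrtrM _ (ltW B_gt0)).
have u_gt0 : 0 < Num.sqrt (t * p + 1 - t) by rewrite sqrtr_gt0.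
have s_gt0 : 0 < Num.sqrt (1 - t) by rewrite sqrtr_gt0.
have := sqr_sqrtr (ltW U_gt0); have := sqr_sqrtr (ltW B_gt0).
set u := Num.sqrt (t * p + 1 - t) in u_gt0 *.
set s := Num.sqrt (1 - t) in s_gt0 *.
move=> s2 u2.
have us_neq0 : u + 2 * s != 0 by rewrite gt_eqF //; lra.
have denE : t * p - 3 + 3 * t = (u - 2 * s) * (u + 2 * s) by nra.
have numE : 1 - t + t * p - 2 * (s * u) = u * (u - 2 * s) by nra.
have p3_neq0 : p + 3 != 0 by rewrite gt_eqF //; lra.
have -> : (t == 3 / (p + 3)) = (u - 2 * s == 0).
  rewrite -(inj_eq (mulIf p3_neq0)) divfK // -subr_eq0.
  rewrite -[RHS](inj_eq (mulIf us_neq0)) -denE mul0r.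
  by congr (_ == _); ring.
have [us|us] := eqVneq (u - 2 * s) 0.
  have -> : u = 2 * s by lra.
  field; lra.
rewrite denE numE; field; exact/andP.
Qed.

(** The inequality on the right is u^2 (1 - r)^2 >= 4 s^2 r^2 in disguise. It is
also the first-order condition at |a_0| = 1 for the inequality of the theorem. *)
Lemma bohr_radius_cond (R : realType) (t p r : R) : 0 < t -> t < 1 -> 0 < p ->
  0 <= r -> r < 1 ->
  (r <= bohr_radius t p) =
  ((1 - t) * ((3 * r - 1) * (1 + r)) <= t * p * (1 - r) ^+ 2).
Proof.
move=> t_gt0 t_lt1 p_gt0 r_ge0 r_lt1; rewrite bohr_radiusE //.
have B_gt0 : 0 < 1 - t by rewrite subr_gt0.
have A_gt0 : 0 < t * p by rewrite mulr_gt0.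
have U_gt0 : 0 < t * p + 1 - t by lra.
have u_gt0 : 0 < Num.sqrt (t * p + 1 - t) by rewrite sqrtr_gt0.
have s_gt0 : 0 < Num.sqrt (1 - t) by rewrite sqrtr_gt0.
have := sqr_sqrtr (ltW U_gt0); have := sqr_sqrtr (ltW B_gt0).
set u := Num.sqrt (t * p + 1 - t) in u_gt0 *.
set s := Num.sqrt (1 - t) in s_gt0 *.
move=> s2 u2.
rewrite ler_pdivlMr; last by lra.
transitivity (2 * s * r <= u * (1 - r)); first by apply/idP/idP; lra.
have rr : 0 <= 1 - r by rewrite subr_ge0 ltW.
rewrite -(ler_pXn2r (ltn0Sn 1)) ?nnegrE ?mulr_ge0 ?(ltW s_gt0) ?(ltW u_gt0) //.
by rewrite !exprMn s2 u2; apply/idP/idP; lra.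
Qed.

Lemma bohr_radius_lt1 (R : realType) (t p : R) : 0 < t -> t < 1 -> 0 < p ->
  0 < bohr_radius t p < 1.
Proof.
move=> t_gt0 t_lt1 p_gt0; rewrite bohr_radiusE //.
have A_gt0 : 0 < t * p by rewrite mulr_gt0.
have u_gt0 : 0 < Num.sqrt (t * p + 1 - t) by rewrite sqrtr_gt0; lra.
have s_gt0 : 0 < Num.sqrt (1 - t) by rewrite sqrtr_gt0; lra.
by rewrite divr_gt0 ?ltr_pdivrMr /=; lra.
Qed.

(** * The inequality within the radius *)

(** Here x stands for the modulus of a_0 and y for that of f(z). After replacing the
power by its tangent, the defect has the factor 1 - x, and the other factor is
least in the limit x = 1, where its sign is given by the condition on r. *)
Lemma bohr_scalar_bound (R : realType) (t p r x y : R) :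
  0 < t -> t < 1 -> 0 < p -> p <= 1 -> 0 <= r -> r < 1 ->
  (1 - t) * ((3 * r - 1) * (1 + r)) <= t * p * (1 - r) ^+ 2 ->
  0 <= x -> x < 1 -> 0 <= y -> y <= (x + r) / (1 + x * r) ->
  t * y `^ p + (1 - t) * (x + (1 - x ^+ 2) * (r / (1 - r))) <= 1.
Proof.
move=> t_gt0 t_lt1 p_gt0 p_le1 r_ge0 r_lt1 cond x_ge0 x_lt1 y_ge0 y_le.
have xr_ge0 : 0 <= x * r by rewrite mulr_ge0.
have d1_gt0 : 0 < 1 + x * r by rewrite ltr_wpDr.
have d2_gt0 : 0 < 1 - r by rewrite subr_gt0.
have d1_neq0 := lt0r_neq0 d1_gt0; have d2_neq0 := lt0r_neq0 d2_gt0.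
set Y := (x + r) / (1 + x * r) in y_le.
have Y_ge0 : 0 <= Y by exact: le_trans y_le.
have yp_le : t * y `^ p <= t * (1 + p * (Y - 1)).
  rewrite ler_pM2l //; apply: le_trans (powR_le_tangent Y_ge0 p_gt0 p_le1).
  by apply: ge0_ler_powR; rewrite ?nnegrE // ltW.
apply: le_trans (lerD yp_le (lexx _)) _; rewrite -subr_ge0.
have -> : 1 - (t * (1 + p * (Y - 1)) + (1 - t) * (x + (1 - x ^+ 2) * (r / (1 - r)))) =
  (1 - x) * (t * p * (1 - r) ^+ 2 - (1 - t) * ((2 * r + x * r - 1) * (1 + x * r)))
  / ((1 + x * r) * (1 - r)) by rewrite /Y; field; apply/andP.
rewrite divr_ge0 ?mulr_ge0 ?(ltW d1_gt0) ?(ltW d2_gt0) ?subr_ge0 ?(ltW x_lt1) //.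
apply: le_trans cond; rewrite ler_wpM2l ?subr_ge0 ?(ltW t_lt1) //.
have xr_le : x * r <= r by rewrite ler_piMl // ltW.
(* Monotonicity of the left-hand side in x * r <= r: the difference of the two
   sides factors. *)
have : 0 <= (r - x * r) * (3 * r + x * r).
  by rewrite mulr_ge0 ?subr_ge0 // addr_ge0 // mulr_ge0.
lra.
Qed.

Lemma bohr_inequality_within (R : realType) (t p : R) (f : R[i] -> R[i]) a z :
  0 < t -> t < 1 -> 0 < p -> p <= 1 -> analytic_self_map f a ->
  normc z <= bohr_radius t p -> bohr_inequality t p f a z.
Proof.
move=> t_gt0 t_lt1 p_gt0 p_le1 [_ fa f_lt1] z_le.
have /andP[_ rad_lt1] := bohr_radius_lt1 t_gt0 t_lt1 p_gt0.
have r_ge0 := normc_ge0 z; have r_lt1 := le_lt_trans z_le rad_lt1.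
have x_lt1 := coef0_lt1 fa f_lt1.
rewrite bohr_radius_cond // in z_le.
have := bohr_scalar_bound t_gt0 t_lt1 p_gt0 p_le1 r_ge0 r_lt1 z_le (normc_ge0 _)
  x_lt1 (normc_ge0 _) (schwarz_pick fa f_lt1 r_lt1).
rewrite -lee_fin EFinD EFinM /bohr_inequality; apply: le_trans.
rewrite leeD2lE // [X in (_ <= X)%E]EFinM.
apply: lee_wpmul2l; first by rewrite lee_fin subr_ge0 ltW.
exact: abs_series_le fa f_lt1 r_ge0 r_lt1.
Qed.

(** * Automorphisms of the disk *)

(** The disk automorphism exchanging 0 and alpha. It attains the Schwarz-Pick bound,
and its coefficients come close to theirs as alpha tends to 1: the ratio for the
k-th one is alpha^(k - 1). *)
Definition blaschke (R : realType) (alpha : R) (w : R[i]) : R[i] :=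
  (alpha%:C - w) / (1 - alpha%:C * w).

Definition blaschke_coef (R : realType) (alpha : R) (k : nat) : R[i] :=
  if k is k'.+1 then (- ((1 - alpha ^+ 2) * alpha ^+ k'))%:C else alpha%:C.

Section blaschke_factor.
Context (R : realType) (alpha : R).
Context (alpha_ge0 : 0 <= alpha) (alpha_lt1 : alpha < 1).

Lemma normc_alphaM (w : R[i]) : normc (alpha%:C * w) = alpha * normc w.
Proof. by rewrite normcM normc_real ger0_norm. Qed.

Lemma normc_alphaM_lt1 (w : R[i]) : unit_disk w -> normc (alpha%:C * w) < 1.
Proof.
rewrite /unit_disk /mkset => w_lt1; rewrite normc_alphaM.
by apply: le_lt_trans w_lt1; rewrite ler_piMl ?normc_ge0 // ltW.
Qed.

Lemma blaschke_den_neq0 (w : R[i]) : unit_disk w -> 1 - alpha%:C * w != 0.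
Proof.
move=> /normc_alphaM_lt1 aw_lt1; rewrite subr_eq0; apply/eqP => aw1.
by move: aw_lt1; rewrite -aw1 normc1 ltxx.
Qed.

Lemma blaschke_lt1 (w : R[i]) : unit_disk w -> normc (blaschke alpha w) < 1.
Proof.
move=> w_disk; have den_neq0 := blaschke_den_neq0 w_disk.
have den_gt0 : 0 < normc (1 - alpha%:C * w).
  rewrite lt_def normc_ge0 andbT; apply: contra den_neq0 => /eqP nc0.
  by apply/eqP/eq0_normc.
rewrite /blaschke normcM normcV ltr_pdivrMr // mul1r.
rewrite -(ltr_pXn2r (ltn0Sn 1)) ?nnegrE ?normc_ge0 //.
have sqE (v : R[i]) : normc v ^+ 2 = complex.Re v ^+ 2 + complex.Im v ^+ 2.
  by case: v => u v; rewrite /= sqr_sqrtr // addr_ge0 ?sqr_ge0.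
have : normc w ^+ 2 < 1 by rewrite expr_lt1 ?normc_ge0.
rewrite !sqE; case: w {w_disk den_neq0 den_gt0} => u v /= uv_lt1.
rewrite !mul0r !subr0 !addr0.
have : 0 < (1 - alpha ^+ 2) * (1 - (u ^+ 2 + v ^+ 2)).
  by rewrite mulr_gt0 ?subr_gt0 // expr_lt1.
lra.
Qed.

Lemma blaschke_analytic : analytic_on (@unit_disk R) (blaschke alpha).
Proof.
move=> w w_disk; rewrite /blaschke.
apply: derivableM.
  apply: derivableB; first exact: derivable_cst.
  exact: derivable_id.
apply: derivableV; first exact: blaschke_den_neq0.
apply: derivableB; first exact: derivable_cst.
apply: derivableM; first exact: derivable_cst.
exact: derivable_id.
Qed.

Lemma blaschke_power_series :
  has_power_series_on (@unit_disk R) (blaschke_coef alpha) (blaschke alpha).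
Proof.
move=> w w_disk; have den_neq0 := blaschke_den_neq0 w_disk.
rewrite -cvg_shiftS /=; apply: cvg_of_normc.
set q := alpha%:C * w in den_neq0 *.
pose tail : R[i] := (1 - alpha ^+ 2)%:C * w / (1 - q).
have remE n : blaschke alpha w -
    series (fun k => blaschke_coef alpha k * w ^+ k) n.+1 = - (tail * q ^+ n).
  rewrite /series /= big_nat_recl // expr0 mulr1 big_mkord /=.
  have -> : \sum_(i < n) (- ((1 - alpha ^+ 2) * alpha ^+ i))%:C * w ^+ i.+1 =
     - ((1 - alpha ^+ 2)%:C * w) * \sum_(i < n) q ^+ i.
    rewrite mulr_sumr; apply: eq_bigr => i _.
    by rewrite /q exprMn (exprS w) rmorphN rmorphM rmorphXn; ring.
  have -> : \sum_(i < n) q ^+ i = (1 - q ^+ n) / (1 - q).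
    apply: (mulfI den_neq0); rewrite mulrCA divff // mulr1.
    by rewrite -opprB mulNr -subrX1 opprB.
  rewrite /tail /blaschke rmorphB rmorph1 rmorphXn; move: (q ^+ n) => Q.
  by rewrite /q in den_neq0 *; field.
under eq_cvg do rewrite remE normcN normcM normcX.
suff : normc tail * normc q ^+ n @[n --> \oo] --> normc tail * 0 by rewrite mulr0.
apply: cvgM; first exact: cvg_cst.
by apply: cvg_expr; rewrite ger0_norm ?normc_ge0 // normc_alphaM_lt1.
Qed.

Lemma blaschke_self_map : analytic_self_map (blaschke alpha) (blaschke_coef alpha).
Proof.
split; first exact: blaschke_analytic.
  exact: blaschke_power_series.
exact: blaschke_lt1.
Qed.

End blaschke_factor.

Lemma blaschke_at_neg (R : realType) (alpha r : R) :
  0 <= alpha -> 0 <= r ->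
  normc (blaschke alpha (- r%:C)) = (alpha + r) / (1 + alpha * r).
Proof.
move=> alpha_ge0 r_ge0.
have -> : blaschke alpha (- r%:C) = ((alpha + r) / (1 + alpha * r))%:C.
  by rewrite /blaschke opprK mulrN opprK -rmorphM -rmorphD
    -(rmorph1 (real_complex R)) -rmorphD -fmorph_div.
by rewrite normc_real ger0_norm // divr_ge0 ?addr_ge0 ?mulr_ge0.
Qed.

(** At the point - r the function takes its largest modulus on the circle, and the
series of moduli is geometric; finite partial sums suffice to pass to the limit. *)
Lemma blaschke_inequality_implies (R : realType) (t p alpha r : R) :
  t <= 1 -> 0 <= alpha -> alpha < 1 -> 0 <= r -> r < 1 ->
  bohr_inequality t p (blaschke alpha) (blaschke_coef alpha) (- r%:C) ->
  t * ((alpha + r) / (1 + alpha * r)) `^ p +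
    (1 - t) * (alpha + (1 - alpha ^+ 2) * (r / (1 - alpha * r))) <= 1.
Proof.
move=> t_le1 alpha_ge0 alpha_lt1 r_ge0 r_lt1.
rewrite /bohr_inequality blaschke_at_neg // normcN normc_real ger0_norm //.
set y := t * _ => ineq.
have ar_ge0 : 0 <= alpha * r by rewrite mulr_ge0.
have ar_lt1 : alpha * r < 1 by rewrite (le_lt_trans _ r_lt1) // ler_piMl // ltW.
pose partial n := y + (1 - t) *
  (alpha + series (geometric ((1 - alpha ^+ 2) * r) (alpha * r)) n).
have partial_cvg : partial n @[n --> \oo] -->
    y + (1 - t) * (alpha + (1 - alpha ^+ 2) * r / (1 - alpha * r)).
  apply: cvgD; first exact: cvg_cst.
  apply: cvgM; first exact: cvg_cst.
  apply: cvgD; first exact: cvg_cst.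
  by apply: cvg_geometric_series; rewrite ger0_norm.
rewrite mulrA; apply: (cvgr_to_le partial_cvg); near=> n.
rewrite -lee_fin; apply: le_trans ineq.
rewrite EFinD leeD2lE // EFinM lee_wpmul2l ?lee_fin ?subr_ge0 //.
apply: le_trans (nneseries_lim_ge n.+1 _); last first.
  by move=> k _ _; rewrite lee_fin mulr_ge0 ?normc_ge0 ?exprn_ge0.
rewrite sumEFin lee_fin big_nat_recl // expr0 mulr1 /series.
have X_ge0 : 0 <= 1 - alpha ^+ 2 by rewrite subr_ge0 ltW // expr_lt1.
have coef0 : normc (blaschke_coef alpha 0) = alpha by rewrite normc_real ger0_norm.
have coefS k : normc (blaschke_coef alpha k.+1) = (1 - alpha ^+ 2) * alpha ^+ k.
  by rewrite normc_real normrN ger0_norm // mulr_ge0 ?exprn_ge0.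
rewrite coef0 lerD2l le_eqVlt; apply/orP; left; apply/eqP/eq_bigr => k _.
by rewrite coefS /geometric /= exprMn (exprS r); ring.
Unshelve. all: by end_near. Qed.

(** * Sharpness *)

(** The strict failure of the radius condition persists for alpha near 1; the
witness is explicit. *)
Lemma exists_bad_alpha (R : realType) (t p r : R) :
  0 < t -> t < 1 -> 0 < p -> p <= 1 -> 0 < r -> r < 1 ->
  t * p * (1 - r) ^+ 2 < (1 - t) * ((3 * r - 1) * (1 + r)) ->
  exists2 alpha, 0 < alpha < 1 &
    t * p * (1 - r) * (1 - alpha * r) <
      (1 - t) * ((r + 2 * (alpha * r) - 1) * (alpha + r)).
Proof.
move=> t_gt0 t_lt1 p_gt0 p_le1 r_gt0 r_lt1 cond.
set gap := (1 - t) * ((3 * r - 1) * (1 + r)) - t * p * (1 - r) ^+ 2.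
have gap_gt0 : 0 < gap by rewrite subr_gt0.
have tp_le1 : t * p <= 1 by rewrite mulr_ile1 // ltW.
have tp_gt0 : 0 < t * p by rewrite mulr_gt0.
have gap_le4 : gap <= 4.
  have : 0 <= t * p * (1 - r) ^+ 2 by rewrite mulr_ge0 ?sqr_ge0 // ltW.
  have : (1 - t) * ((3 * r - 1) * (1 + r)) <= 4 by nra.
  by rewrite /gap; lra.
(* At alpha = 1 the two sides differ by gap; going down to 1 - delta costs at
   most 7 * delta. *)
pose delta := gap / 8.
have delta_gt0 : 0 < delta by rewrite divr_gt0.
have delta_le : delta <= 1 / 2 by rewrite /delta; lra.
exists (1 - delta); first by lra.
have slope : t * p * (r * (1 - r)) + (1 - t) * (3 * r - 1 + 2 * r * (1 + r)) <= 7.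
  have h1 : r * (1 - r) <= 1 by nra.
  have h0 : 0 <= r * (1 - r) by rewrite mulr_ge0 ?subr_ge0 // ltW.
  have h2 : t * p * (r * (1 - r)) <= 1 by rewrite mulr_ile1 // ltW.
  have h3 : (1 - t) * (3 * r - 1 + 2 * r * (1 + r)) <= 6 by nra.
  lra.
have h4 : delta * (t * p * (r * (1 - r)) + (1 - t) * (3 * r - 1 + 2 * r * (1 + r)))
   <= delta * 7 by rewrite ler_wpM2l // ltW.
have h5 : 0 <= 2 * delta ^+ 2 * (r * (1 - t)).
  by rewrite !mulr_ge0 ?sqr_ge0 ?subr_ge0 // ltW.
have gapE : gap = 8 * delta by rewrite /delta; field.
rewrite /gap in gapE; lra.
Qed.

Lemma bohr_radius_sharp (R : realType) (t p r : R) :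
  0 < t -> t < 1 -> 0 < p -> p <= 1 -> bohr_radius t p < r -> r < 1 ->
  exists f a z,
    [/\ analytic_self_map f a, normc z <= r & ~ bohr_inequality t p f a z].
Proof.
move=> t_gt0 t_lt1 p_gt0 p_le1 rad_lt r_lt1.
have /andP[rad_gt0 _] := bohr_radius_lt1 t_gt0 t_lt1 p_gt0.
have r_gt0 := lt_trans rad_gt0 rad_lt.
move: rad_lt; rewrite ltNge bohr_radius_cond ?(ltW r_gt0) // -ltNge => cond.
have [alpha /andP[alpha_gt0 alpha_lt1] bad] :=
  exists_bad_alpha t_gt0 t_lt1 p_gt0 p_le1 r_gt0 r_lt1 cond.
exists (blaschke alpha), (blaschke_coef alpha), (- r%:C); split.
- exact: blaschke_self_map (ltW alpha_gt0) alpha_lt1.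
- by rewrite normcN normc_real ger0_norm // ltW.
move=> /(blaschke_inequality_implies (ltW t_lt1) (ltW alpha_gt0) alpha_lt1
  (ltW r_gt0) r_lt1).
have d1_gt0 : 0 < 1 + alpha * r by rewrite ltr_wpDr // mulr_ge0 // ltW.
have d2_gt0 : 0 < alpha + r by rewrite addr_gt0.
have d3_gt0 : 0 < 1 - alpha * r.
  by rewrite subr_gt0 (lt_trans _ r_lt1) // gtr_pMl.
have Y_gt0 : 0 < (alpha + r) / (1 + alpha * r) by rewrite divr_gt0.
have := powR_ge_tangent_inv Y_gt0 p_gt0 p_le1.
rewrite -(ler_pM2l t_gt0) invf_div; set v := _ `^ p => tangent main.
have : 0 <= t * (p * ((1 + alpha * r) / (alpha + r) - 1))
    + (1 - t) * (1 - (alpha + (1 - alpha ^+ 2) * (r / (1 - alpha * r)))) by lra.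
have -> : t * (p * ((1 + alpha * r) / (alpha + r) - 1))
    + (1 - t) * (1 - (alpha + (1 - alpha ^+ 2) * (r / (1 - alpha * r)))) =
    (1 - alpha) * (t * p * (1 - r) * (1 - alpha * r)
       - (1 - t) * ((r + 2 * (alpha * r) - 1) * (alpha + r)))
    / ((alpha + r) * (1 - alpha * r)).
  by field; rewrite !gt_eqF.
rewrite pmulr_lge0 ?invr_gt0 ?mulr_gt0 // pmulr_rge0 ?subr_gt0 //.
by rewrite subr_ge0 leNgt bad.
Qed.

Unset Implicit Arguments.
Set Strict Implicit.
Local Close Scope classical_set_scope.

Theorem theorem3p3 (R : realType) (t p : R)
    (t_gt0 : 0 < t) (t_lt1 : t < 1) (p_gt0 : 0 < p) (p_le1 : p <= 1) :
  (forall (f : R[i] -> R[i]) (a : nat -> R[i]), analytic_self_map f a ->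
     forall z : R[i], normc z <= bohr_radius t p -> bohr_inequality t p f a z)
  /\
  (forall R' : R, bohr_radius t p < R' -> R' < 1 ->
     exists (f : R[i] -> R[i]) (a : nat -> R[i]) (z : R[i]),
       [/\ analytic_self_map f a, normc z <= R'
         & ~ bohr_inequality t p f a z]).
Proof.
split=> [f a fa z|R' rad_lt R'_lt1].
  exact: bohr_inequality_within.
exact: bohr_radius_sharp.
Qed.
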